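(* Let $G$ and $H$ be finite graphs and let $G\cup H$ denote their disjoint union. Then (i) $\gamma_{\rm MB}(G)+\gamma_{\rm MB}(H)\le \gamma_{\rm MB}(G\cup H)\le \min\{\gamma_{\rm MB}'(G)+\gamma_{\rm MB}(H),\ \gamma_{\rm MB}(G)+\gamma_{\rm MB}'(H)\}$; (ii) $\max\{\gamma_{\rm MB}'(G)+\gamma_{\rm MB}(H),\ \gamma_{\rm MB}(G)+\gamma_{\rm MB}'(H)\}\le \gamma_{\rm MB}'(G\cup H)\le \gamma_{\rm MB}'(G)+\gamma_{\rm MB}'(H)$. Moreover, each of these four bounds is sharp, i.e. attained with equality for some pair of graphs $G,H$.
   Context: All graphs are finite and simple. The Maker-Breaker domination game on a graph: Dominator and Staller alternately select a vertex not selected before; Dominator wins if at some point his selected vertices form a dominating set, Staller wins otherwise. In the D-game Dominator moves first, in the S-game Staller moves first. $\gamma_{\rm MB}(G)$ (resp. $\gamma_{\rm MB}'(G)$) is the minimum $k$ such that Dominator has a strategy in the D-game (resp. S-game) guaranteeing that his selected vertices dominate $G$ after at most $k$ of his moves, whatever Staller does, and is $\infty$ if he has no winning strategy. Arithmetic and comparisons follow the convention that $\infty+a=\infty$ and $\infty$ exceeds every integer. *)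

(* Defs.v *)
From mathcomp Require Import all_boot all_order all_algebra.
From mathcomp Require Import boolp constructive_ereal.

Set Implicit Arguments.
Unset Strict Implicit.
Unset Printing Implicit Defensive.

Record sgraph := SGraph {
  vertex :> finType;
  adj : rel vertex;
  adj_sym : symmetric adj;
  adj_irr : irreflexive adj }.

Definition dominating (G : sgraph) (D : {set G}) : bool :=
  [forall v, (v \in D) || [exists u in D, adj u v]].

Section DisjointUnion.
Variables G H : sgraph.

Definition union_adj : rel (G + H)%type := fun x y =>
  match x, y with
  | inl u, inl v => adj u v
  | inr u, inr v => adj u v
  | _, _ => false
  end.

Fact union_adj_sym : symmetric union_adj.
Proof. by move=> [x|x] [y|y] //=; rewrite adj_sym. Qed.

Fact union_adj_irr : irreflexive union_adj.
Proof. by move=> [x|x] /=; rewrite adj_irr. Qed.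

Definition disjoint_union : sgraph :=
  @SGraph (G + H)%type union_adj union_adj_sym union_adj_irr.

End DisjointUnion.

Variant game := DGame | SGame.

(* Moves are numbered from 0. *)
Definition dominator_turn (g : game) (i : nat) : bool :=
  match g with DGame => ~~ odd i | SGame => odd i end.

Section MakerBreaker.
Variable G : sgraph.

(* The argument is the sequence of all moves made so far, by both players.
   The codomain is an option type so that the graph without vertices, where
   there is no move to choose, still has a strategy. *)
Definition strategy := seq G -> option G.

Definition legal (sigma : strategy) : Prop :=
  forall h : seq G, uniq h -> size h < #|G| ->
    exists2 v, sigma h = Some v & v \notin h.

(* Play goes on until every vertex is selected: moves made after Dominator
   has won do not change the outcome. *)
Definition complete_play (p : seq G) : Prop := uniq p /\ size p = #|G|.

Definition follows (g : game) (sigma : strategy) (p : seq G) : Prop :=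
  forall i, i < size p -> dominator_turn g i -> sigma (take i p) = onth p i.

Definition dominator_moves (g : game) (p : seq G) : seq G :=
  mask [seq dominator_turn g i | i <- iota 0 (size p)] p.

(* If fewer than k moves already dominate, then so do the first k, because a
   superset of a dominating set is dominating. *)
Definition guarantees (g : game) (sigma : strategy) (k : nat) : Prop :=
  forall p : seq G, complete_play p -> follows g sigma p ->
    dominating [set x in take k (dominator_moves g p)].

Definition dominator_wins_within (g : game) (k : nat) : Prop :=
  exists2 sigma : strategy, legal sigma & guarantees g sigma k.

Definition MBnumber (g : game) : \bar int :=
  match pselect (exists k, `[< dominator_wins_within g k >]) with
  | left exk => (Posz (ex_minn exk))%:E
  | right _ => +oo%E
  end.

Definition gammaMB : \bar int := MBnumber DGame.
Definition gammaMB' : \bar int := MBnumber SGame.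

End MakerBreaker.

(* Main.v *)
(** A position is a pair [(D, F)] of Dominator's vertices and the free vertices,
    and a position on a disjoint union is a pair of positions.  For the lower
    bounds Staller answers in the component where Dominator has just played; for
    the upper bounds Dominator answers in the component where Staller has just
    played.  The parity problem of an exhausted component is absorbed by
    monotonicity: more free vertices, or having the move, never hurts Dominator.
    All four bounds are attained by two copies of [K_2], since both invariants
    of [K_2] equal 1. *)
Require Import Defs.
From mathcomp Require Import all_boot all_order all_algebra.
From mathcomp Require Import boolp constructive_ereal.

Set Implicit Arguments.
Unset Strict Implicit.
Unset Printing Implicit Defensive.

Import Order.TTheory.

(** * Positions, move budgets and monotonicity *)

Section PositionalGame.
Variables (T : finType) (P : {set T} -> bool).
Implicit Types (D F : {set T}).

(* Dominator, who holds [D] and has the move iff [t], can make [P] true of his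
   set within [k] more moves; Staller's vertices are those outside [D] and [F].
   The witness [u] of [wins_stal] makes a full board without [P D] a loss. *)
Inductive wins : bool -> nat -> {set T} -> {set T} -> Prop :=
| wins_now t k D F of P D : wins t k D F
| wins_dom k D F v of v \in F & wins false k (v |: D) (F :\ v) :
    wins true k.+1 D F
| wins_stal k D F u of u \in F &
    (forall v, v \in F -> wins true k D (F :\ v)) : wins false k D F.

(** A Staller turn that is skipped, or spent outside [F], leaves Dominator at least as well off as
    Staller's move [u], so the induction hypothesis for [u] covers both cases. *)
Lemma wins_monotone t k D F : wins t k D F ->
  forall t' k' F', t ==> t' -> k <= k' -> F \subset F' -> wins t' k' D F'.
Proof.
elim=> {t k D F} [t k D F PD|k D F v vF _ IH|k D F u uF _ IH] t' k' F'.
- by move=> *; apply: wins_now.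
- case: t' => // _; case: k' => // k' lek sFF'.
  apply: (@wins_dom _ _ _ v); first exact: (subsetP sFF').
  by apply: IH => //; apply: setSD.
- case: t' => _ lek sFF'.
    by apply: (IH u) => //; apply: subset_trans sFF'; apply: subD1set.
  apply: (@wins_stal _ _ _ u) => [|v vF']; first exact: (subsetP sFF').
  have [vF|vF] := boolP (v \in F); first by apply: (IH v) => //; apply: setSD.
  apply: (IH u) => //; apply: subset_trans (subD1set _ _) _.
  by rewrite subsetD1 sFF'.
Qed.

Lemma wins_exhausted t k D F : F = set0 -> wins t k D F -> P D.
Proof.
by move=> F0 W; case: W F0 => // {}k {}D {}F v vF _ F0; rewrite F0 inE in vF.
Qed.

(** [wins_dom] needs a positive budget, so along the witnesses [u] the set [D] stays the same until
    [wins_now] applies. *)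
Lemma wins_zero t k D F : k = 0 -> wins t k D F -> P D.
Proof. by move=> k0 W; elim: W k0 => // {}k {}D {}F u uF _ IH /(IH _ uF). Qed.

Lemma wins_inv t k D F : wins t k D F -> ~~ P D ->
  if t then exists2 v, v \in F & wins false k.-1 (v |: D) (F :\ v)
  else forall v, v \in F -> wins true k D (F :\ v).
Proof.
case=> {t k D F} [t k D F ->|k D F v vF W _|k D F u _ W _] //.
by exists v.
Qed.

End PositionalGame.

(** * Preimages of positions under an injection *)

Lemma preimsetU1 (T V : finType) (f : T -> V) v (D : {set V}) :
  injective f -> f @^-1: (f v |: D) = v |: f @^-1: D.
Proof. by move=> fI; apply/setP=> x; rewrite !inE (inj_eq fI). Qed.

Lemma preimsetU1_notin (T V : finType) (f : T -> V) z (D : {set V}) :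
  (forall x, f x != z) -> f @^-1: (z |: D) = f @^-1: D.
Proof. by move=> fz; apply/setP=> x; rewrite !inE (negPf (fz x)). Qed.

Lemma preimsetD1 (T V : finType) (f : T -> V) v (D : {set V}) :
  injective f -> f @^-1: (D :\ f v) = f @^-1: D :\ v.
Proof. by move=> fI; apply/setP=> x; rewrite !inE (inj_eq fI). Qed.

Lemma preimsetD1_notin (T V : finType) (f : T -> V) z (D : {set V}) :
  (forall x, f x != z) -> f @^-1: (D :\ z) = f @^-1: D.
Proof. by move=> fz; apply/setP=> x; rewrite !inE (negPf (fz x)). Qed.

(* If what happens outside the image of [f] is irrelevant to the goal, Staller
   gains nothing by moving there. *)
Lemma wins_embedding (U V : finType) (f : U -> V)
    (Q : {set U} -> bool) (R : {set V} -> bool) t k (D2 F2 : {set U}) :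
    injective f -> wins Q t k D2 F2 -> forall D F : {set V},
    (forall D' : {set V}, D \subset D' -> Q (f @^-1: D') -> R D') ->
    f @^-1: D = D2 -> f @^-1: F = F2 -> wins R t k D F.
Proof.
move=> fI; elim=> {t k D2 F2} [t k D2 F2 QD|k D2 F2 v vF _ IH|k D2 F2 u uF _ IH].
- by move=> D F QR eD eF; apply/wins_now/QR => //; rewrite eD.
- move=> D F QR eD eF; apply: (@wins_dom _ _ _ _ _ (f v)).
    by rewrite -eF inE in vF.
  apply: IH; rewrite ?preimsetU1 ?preimsetD1 ?eD ?eF // => D' sDD'.
  by apply: QR; apply: subset_trans sDD'; apply: subsetUr.
move=> D F QR eD eF; apply: (@wins_stal _ _ _ _ _ (f u)).
  by rewrite -eF inE in uF.
move=> z zF; have [/codomP[v ez]|zf] := boolP (z \in codom f).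
  by apply: (IH v); rewrite ?ez ?preimsetD1 ?eF // -eF inE -ez.
have fz x : f x != z by apply: contraNneq zf => <-; apply: codom_f.
(* Staller is charged with [f u] in addition to [z]; the hypothesis for [u] then applies. *)
apply: (@wins_monotone _ _ true k D (F :\ z :\ f u)) => //; last exact: subD1set.
by apply: (IH u) => //; rewrite preimsetD1 // preimsetD1_notin // eF.
Qed.

(** * Division of the budget between two components *)

Section Split.
Variables (T U : finType) (P : {set T} -> bool) (Q : {set U} -> bool).

Definition splits t1 t2 k (D1 F1 : {set T}) (D2 F2 : {set U}) :=
  exists k1 k2, [/\ k1 + k2 <= k, wins P t1 k1 D1 F1 & wins Q t2 k2 D2 F2].

(** The division of [k] may depend on Staller's move. Giving the second component the least budget
    that suffices there leaves [k - k2] for the first one, uniformly in Staller's move there. *)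
Lemma splits_staller k (D1 F1 : {set T}) (D2 F2 : {set U}) :
    (forall v, v \in F1 -> splits true true k D1 (F1 :\ v) D2 F2) ->
    (forall v, v \in F2 -> splits true true k D1 F1 D2 (F2 :\ v)) ->
    F1 != set0 \/ F2 != set0 ->
  splits false true k D1 F1 D2 F2.
Proof.
move=> H1 H2 F0.
have [F10|/set0Pn[u uF]] := eqVneq F1 set0.
  (* The exhausted component has already reached its goal; in the other one Staller's vertex [v] is
     given back. *)
  case: F0 => [|/set0Pn[v /H2[k1 [k2 [lek W1 W2]]]]]; first by rewrite F10 eqxx.
  exists k1, k2; split=> //; first exact: wins_now (wins_exhausted F10 W1).
  exact: wins_monotone W2 _ _ _ _ _ (subD1set _ _).
have exk : exists k2, `[< wins Q true k2 D2 F2 >].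
  by have [_ [k2 [_ _ W2]]] := H1 u uF; exists k2; apply/asboolP.
case: (ex_minnP exk) => k2 /asboolP W2 k2_min.
have le_sub v : v \in F1 -> wins P true (k - k2) D1 (F1 :\ v) /\ k2 <= k.
  move=> /H1[i [j [leij W1 /asboolP/k2_min lek2]]].
  have leik : i + k2 <= k by apply: leq_trans leij; rewrite leq_add2l.
  have lek : k2 <= k by apply: leq_trans leik; apply: leq_addl.
  by split=> //; apply: (wins_monotone W1) => //; rewrite leq_subRL // addnC.
exists (k - k2), k2; split=> //; first by rewrite subnK //; case: (le_sub u uF).
by apply: (@wins_stal _ _ _ _ _ u) => // v /le_sub[].
Qed.

End Split.

Lemma splits_sym (T U : finType) (P : {set T} -> bool) (Q : {set U} -> bool)
    t1 t2 k (D1 F1 : {set T}) (D2 F2 : {set U}) :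
  splits P Q t1 t2 k D1 F1 D2 F2 -> splits Q P t2 t1 k D2 F2 D1 F1.
Proof. by case=> k1 [k2 [lek W1 W2]]; exists k2, k1; rewrite addnC. Qed.

(** * The game on a disjoint sum of boards *)

Section Sum.
Variables (T U : finType) (P : {set T} -> bool) (Q : {set U} -> bool).
Hypothesis P_mono : forall A B : {set T}, A \subset B -> P A -> P B.
Hypothesis Q_mono : forall A B : {set U}, A \subset B -> Q A -> Q B.

Definition sum_goal (A : {set T + U}) := P (inl @^-1: A) && Q (inr @^-1: A).

Let inlI : injective (@inl T U). Proof. by move=> x y []. Qed.
Let inrI : injective (@inr T U). Proof. by move=> x y []. Qed.

(** The condition on the turns is the invariant of Staller's local answers: Dominator's move passes
    the turn in one component only, and Staller's answer there gives it back. *)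
Lemma wins_sum_splits t k (D F : {set T + U}) : wins sum_goal t k D F ->
  forall t1 t2, (if t then t1 && t2 else t1 (+) t2) ->
  splits P Q t1 t2 k (inl @^-1: D) (inl @^-1: F) (inr @^-1: D) (inr @^-1: F).
Proof.
elim=> {t k D F} [t k D F /andP[PD QD]|k D F [v|v] vF _ IH|k D F u uF _ IH] t1 t2.
- by exists 0, 0; split=> //; apply: wins_now.
(* Dominator has played on the left: Staller is to move there, Dominator still on the right. *)
- case/andP=> -> ->; have [k1 [k2 []]] := IH false true isT.
  rewrite preimsetU1 // preimsetD1 // preimsetU1_notin // preimsetD1_notin //.
  move=> lek W1 W2; exists k1.+1, k2; split=> //.
  by apply: wins_dom W1; rewrite inE.
- case/andP=> -> ->; have [k1 [k2 []]] := IH true false isT.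
  rewrite preimsetU1 // preimsetD1 // preimsetU1_notin // preimsetD1_notin //.
  move=> lek W1 W2; exists k1, k2.+1; split=> //; first by rewrite addnS.
  by apply: wins_dom W2; rewrite inE.
have HL v : v \in inl @^-1: F -> splits P Q true true k
    (inl @^-1: D) (inl @^-1: F :\ v) (inr @^-1: D) (inr @^-1: F).
  rewrite inE => /IH /(_ true true isT).
  by rewrite preimsetD1 // preimsetD1_notin.
have HR v : v \in inr @^-1: F -> splits P Q true true k
    (inl @^-1: D) (inl @^-1: F) (inr @^-1: D) (inr @^-1: F :\ v).
  rewrite inE => /IH /(_ true true isT).
  by rewrite preimsetD1 // preimsetD1_notin.
have F0 : inl @^-1: F != set0 \/ inr @^-1: F != set0.
  by case: u uF => u uF; [left|right]; apply/set0Pn; exists u; rewrite inE.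
case: t1 t2 => [] [] // _; last exact: splits_staller.
apply/splits_sym/splits_staller => [v /HR|v /HL|]; try exact: splits_sym.
by case: F0; [right|left].
Qed.

(** Dominator makes the move due in the one component where he has the turn; then Staller is to move
    in both, and each of his moves is answered where it was made. *)
Lemma wins_sum_merge : forall t1 k1 (D1 F1 : {set T}), wins P t1 k1 D1 F1 ->
  forall t2 k2 (D2 F2 : {set U}), wins Q t2 k2 D2 F2 -> ~~ (t1 && t2) ->
  forall D F : {set T + U},
    inl @^-1: D = D1 -> inl @^-1: F = F1 ->
    inr @^-1: D = D2 -> inr @^-1: F = F2 ->
  wins sum_goal (t1 || t2) (k1 + k2) D F.
Proof.
(* Once one goal is reached, its component is irrelevant and [wins_embedding] carries over the win
   in the other. *)
have Pdone t k t' k' (D2 F2 : {set U}) (D F : {set T + U}) :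
    P (inl @^-1: D) -> wins Q t k D2 F2 -> t ==> t' -> k <= k' ->
    inr @^-1: D = D2 -> inr @^-1: F = F2 -> wins sum_goal t' k' D F.
  move=> PD W tt' lek eD eF; apply: wins_monotone tt' lek (subxx _).
  apply: (wins_embedding inrI W) eD eF => D' sDD' QD'.
  by rewrite /sum_goal QD' (P_mono _ PD) ?preimsetS.
have Qdone t k t' k' (D1 F1 : {set T}) (D F : {set T + U}) :
    Q (inr @^-1: D) -> wins P t k D1 F1 -> t ==> t' -> k <= k' ->
    inl @^-1: D = D1 -> inl @^-1: F = F1 -> wins sum_goal t' k' D F.
  move=> QD W tt' lek eD eF; apply: wins_monotone tt' lek (subxx _).
  apply: (wins_embedding inlI W) eD eF => D' sDD' PD'.
  by rewrite /sum_goal PD' (Q_mono _ QD) ?preimsetS.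
move=> t1 k1 D1 F1; elim=> {t1 k1 D1 F1}
  [t1 k1 D1 F1 PD|k1 D1 F1 v vF W IH|k1 D1 F1 u uF W IH].
- move=> t2 k2 D2 F2 W2 _ D F eD1 eF1 eD2 eF2.
  apply: Pdone W2 _ _ eD2 eF2; rewrite ?eD1 ?leq_addl //.
  by apply/implyP=> ->; rewrite orbT.
- move=> [] // k2 D2 F2 W2 _ D F eD1 eF1 eD2 eF2.
  rewrite addSn; apply: (@wins_dom _ _ _ _ _ (inl v)).
    by rewrite -eF1 inE in vF.
  by apply: (IH _ _ _ _ W2); rewrite // ?preimsetU1 ?preimsetD1
    ?preimsetU1_notin ?preimsetD1_notin // ?eD1 ?eF1.
(* The inner induction keeps the left game fixed while the right one advances; a Staller move on the
   left returns to the outer hypothesis with the right game intact. *)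
move=> t2 k2 D2 F2; elim=> {t2 k2 D2 F2}
  [t2 k2 D2 F2 QD|k2 D2 F2 v vF W2 IH2|k2 D2 F2 u2 uF2 W2 IH2] _ D F eD1 eF1 eD2 eF2.
- apply: Qdone (wins_stal uF W) _ _ eD1 eF1; rewrite ?eD2 ?leq_addr //.
- rewrite addnS; apply: (@wins_dom _ _ _ _ _ (inr v)).
    by rewrite -eF2 inE in vF.
  by apply: IH2; rewrite // ?preimsetU1 ?preimsetD1
    ?preimsetU1_notin ?preimsetD1_notin // ?eD2 ?eF2.
apply: (@wins_stal _ _ _ _ _ (inl u)); first by rewrite -eF1 inE in uF.
case=> v vF.
  have vF1 : v \in F1 by rewrite -eF1 inE.
  apply: (IH v vF1 _ _ _ _ (wins_stal uF2 W2)) => //.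
    by rewrite preimsetD1 // eF1.
  by rewrite preimsetD1_notin.
apply: (IH2 v) => //; first by rewrite -eF2 inE.
  by rewrite preimsetD1_notin.
by rewrite preimsetD1 // eF2.
Qed.

End Sum.

(** * Domination in a disjoint union *)

Lemma dominating_mono (G : sgraph) (A B : {set G}) :
  A \subset B -> dominating A -> dominating B.
Proof.
move=> /subsetP sAB /forallP domA; apply/forallP=> v; apply/orP.
case/orP: (domA v) => [/sAB|/exists_inP[u uA uv]]; first by left.
by right; apply/exists_inP; exists u => //; apply: sAB.
Qed.

Lemma dominating_disjoint_union (G H : sgraph) (D : {set disjoint_union G H}) :
  dominating D = sum_goal (@dominating G) (@dominating H) D.
Proof.
apply/forallP/andP => [dom|[/forallP domG /forallP domH] [v|v]].
- split; apply/forallP=> v; rewrite inE.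
    case/orP: (dom (inl v)) => [->//|/exists_inP[[u|u] uD uv] //].
    by apply/orP; right; apply/exists_inP; exists u; rewrite ?inE.
  case/orP: (dom (inr v)) => [->//|/exists_inP[[u|u] uD uv] //].
  by apply/orP; right; apply/exists_inP; exists u; rewrite ?inE.
- case/orP: (domG v) => [|/exists_inP[u]]; rewrite inE => uD; first by rewrite uD.
  by move=> uv; apply/orP; right; apply/exists_inP; exists (inl u).
case/orP: (domH v) => [|/exists_inP[u]]; rewrite inE => uD; first by rewrite uD.
by move=> uv; apply/orP; right; apply/exists_inP; exists (inr u).
Qed.

(** * Equivalence of strategies on histories and winning positions *)

Section Strategies.
Variable G : sgraph.
Implicit Types (g : game) (h p r : seq G) (k : nat) (v : G).

Let held g h : {set G} := [set x in dominator_moves g h].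
Let free h : {set G} := [set x | x \notin h].

Lemma dominator_moves_rcons g h v :
  dominator_moves g (rcons h v) =
    if dominator_turn g (size h) then rcons (dominator_moves g h) v
    else dominator_moves g h.
Proof.
rewrite /dominator_moves size_rcons -addn1 iotaD map_cat -cats1 mask_cat.
  by rewrite add0n /=; case: ifP => _; rewrite ?cats1 ?cats0.
by rewrite size_map size_iota.
Qed.

Lemma dominator_turnS g n : dominator_turn g n.+1 = ~~ dominator_turn g n.
Proof. by case: g => /=; rewrite ?negbK. Qed.

Lemma free_rcons h v : free (rcons h v) = free h :\ v.
Proof. by apply/setP=> x; rewrite !inE mem_rcons inE negb_or. Qed.

Lemma held_rcons_turn g h v : dominator_turn g (size h) ->
  held g (rcons h v) = v |: held g h.
Proof.
by move=> t; apply/setP=> x; rewrite !inE dominator_moves_rcons t mem_rcons inE.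
Qed.

Lemma held_rcons_noturn g h v : ~~ dominator_turn g (size h) ->
  held g (rcons h v) = held g h.
Proof. by move=> /negPf t; rewrite /held dominator_moves_rcons t. Qed.

Lemma follows_rcons g sigma h v : follows g sigma h ->
    (dominator_turn g (size h) -> sigma h = Some v) ->
  follows g sigma (rcons h v).
Proof.
move=> fol sigv i; rewrite size_rcons ltnS leq_eqVlt => /orP[/eqP ->|lti] t.
  by rewrite -cats1 take_size_cat // onth_cat ltnn subnn sigv.
by rewrite -cats1 takel_cat ?(ltnW lti) // onth_cat lti fol.
Qed.

Lemma free_exists h : size h < #|G| -> exists v, v \in free h.
Proof.
move=> lth; have /subsetPn[v _ vh] : ~~ ([set: G] \subset h).
  apply: contraL lth => /subset_leq_card; rewrite cardsT -leqNgt => leG.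
  exact: leq_trans leG (card_size _).
by exists v; rewrite inE.
Qed.

Lemma free_exhausted h : complete_play h -> free h = set0.
Proof.
case=> uh sh; apply/setP=> x; rewrite !inE; apply/negbTE/negP=> xh.
have /card_uniqP cardxh : uniq (x :: h) by rewrite /= xh.
by have := max_card [in x :: h]; rewrite cardxh /= sh ltnn.
Qed.

(** Backward induction on the number [n] of moves left. Past [k] Dominator moves no budget remains
    to speak of, so the claim becomes that the first [k] of them dominate. *)
Lemma wins_of_guarantees g sigma k n h :
    legal sigma -> guarantees g sigma k ->
    uniq h -> size h + n = #|G| -> follows g sigma h ->
  if size (dominator_moves g h) <= k
  then wins (@dominating G) (dominator_turn g (size h))
         (k - size (dominator_moves g h)) (held g h) (free h)
  else dominating [set x in take k (dominator_moves g h)].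
Proof.
move=> leg gua; elim: n h => [|n IH] h uh.
  rewrite addn0 => sh fol; have := gua h (conj uh sh) fol.
  by case: ifP => // lek; rewrite take_oversize // => ?; apply: wins_now.
move=> sh fol; have lth : size h < #|G| by rewrite -sh -addSnnS leq_addr.
have step v : v \notin h -> (dominator_turn g (size h) -> sigma h = Some v) ->
  if size (dominator_moves g (rcons h v)) <= k
  then wins (@dominating G) (dominator_turn g (size h).+1)
         (k - size (dominator_moves g (rcons h v)))
         (held g (rcons h v)) (free h :\ v)
  else dominating [set x in take k (dominator_moves g (rcons h v))].
  move=> vh sigv; have := IH (rcons h v); rewrite rcons_uniq vh size_rcons addSnnS.
  by rewrite -free_rcons; apply=> //; apply: follows_rcons.
case: (boolP (dominator_turn g (size h))) step => t step.
  have [v sigv vh] := leg h uh lth; have := step v vh (fun=> sigv).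
  rewrite held_rcons_turn // dominator_moves_rcons dominator_turnS t size_rcons /=.
  case: ltngtP => [ltk|ltk|eqk].
  - by move=> W; rewrite -(subnSK ltk); apply: wins_dom W; rewrite inE.
  - by rewrite -cats1 takel_cat // ltnW.
  (* All [k] moves are spent, so the set that dominates after the next move is the one already
     held. *)
  rewrite -cats1 takel_cat -?eqk // take_size => domh.
  exact: wins_now.
have [u uF] := free_exists lth.
move: step; rewrite dominator_turnS (negPf t) /= => step.
case: ifP => lek; last first.
  have := step u; rewrite inE in uF; move/(_ uF (fun e => False_ind _ (notF e))).
  by rewrite dominator_moves_rcons (negPf t) lek.
apply: (wins_stal uF) => v vF.
have := step v; rewrite inE in vF; move/(_ vF (fun e => False_ind _ (notF e))).
by rewrite held_rcons_noturn // dominator_moves_rcons (negPf t) lek.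
Qed.

Definition winning_move g k h v :=
  v \in free h /\
  wins (@dominating G) false (k - size (dominator_moves g h)).-1
    (v |: held g h) (free h :\ v).

(** The fallback to any free vertex keeps the strategy legal on histories without a winning move. *)
Definition winning_strategy g k : strategy G := fun h =>
  if [pick v | `[< winning_move g k h v >]] is Some v then Some v
  else [pick v in free h].

Lemma winning_strategy_legal g k : legal (winning_strategy g k).
Proof.
move=> h _ lth; rewrite /winning_strategy; case: pickP => [v /asboolP[vF _]|_].
  by exists v; rewrite // inE in vF *.
case: pickP => [v vF|F0]; first by exists v; rewrite // inE in vF *.
by have [v] := free_exists lth; rewrite F0.
Qed.

(** Induction on the rest [r] of the play: until Dominator's set dominates, each move leads to a
    position that is again won within the remaining budget. *)
Lemma winning_strategy_wins g k r h :
    complete_play (h ++ r) -> follows g (winning_strategy g k) (h ++ r) ->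
    size (dominator_moves g h) <= k ->
    wins (@dominating G) (dominator_turn g (size h))
      (k - size (dominator_moves g h)) (held g h) (free h) ->
  dominating [set x in take k (dominator_moves g (h ++ r))].
Proof.
have now h' r' : size (dominator_moves g h') <= k -> dominating (held g h') ->
    dominating [set x in take k (dominator_moves g (h' ++ r'))].
  move=> lek; apply: dominating_mono; apply/subsetP=> x; rewrite !inE => xh.
  have [s ->] : exists s, dominator_moves g (h' ++ r') = dominator_moves g h' ++ s.
    rewrite /dominator_moves size_cat iotaD map_cat mask_cat ?size_map ?size_iota //.
    by eexists.
  by rewrite take_cat ltnNge lek /= mem_cat xh.
elim: r h => [|v r IH] h com fol lek W.
  apply: now => //; apply: wins_exhausted W.
  by apply: free_exhausted; rewrite cats0 in com.
have vh : v \notin h.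
  by case: com => + _; rewrite cat_uniq /= negb_or => /and3P[_ /andP[]].
have vF : v \in free h by rewrite inE.
have catr : h ++ v :: r = rcons h v ++ r by rewrite cat_rcons.
have [domh|ndomh] := boolP (dominating (held g h)); first exact: now.
have sigv : dominator_turn g (size h) -> winning_strategy g k h = Some v.
  move=> t; have := fol (size h) _ t.
  rewrite size_cat /= addnS ltnS leq_addr take_size_cat // onth_cat ltnn subnn /=.
  exact.
rewrite catr; rewrite catr in com fol; apply: IH => //.
  rewrite dominator_moves_rcons; case: ifP => // t; rewrite size_rcons.
  (* A zero budget would mean that the held set dominates already, so a move is left. *)
  rewrite ltn_neqAle lek andbT; apply: contra ndomh => /eqP eqk.
  by apply: wins_zero W; rewrite eqk subnn.
rewrite size_rcons dominator_turnS free_rcons.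
case: (boolP (dominator_turn g (size h))) sigv W => t sigv W; last first.
  rewrite held_rcons_noturn // dominator_moves_rcons (negPf t) /=.
  exact: (wins_inv W).
have mv : exists v', winning_move g k h v'.
  by have [v' v'F W'] := wins_inv W ndomh; exists v'.
move: (sigv isT); rewrite /winning_strategy; case: pickP => [w /asboolP[_ Ww] [<-]|nomv].
  by rewrite held_rcons_turn // dominator_moves_rcons t size_rcons subnS.
by have [v' /asboolP] := mv; rewrite nomv.
Qed.

Lemma dominator_wins_withinP g k :
  dominator_wins_within G g k <->
  wins (@dominating G) (dominator_turn g 0) k set0 setT.
Proof.
have held0 : held g [::] = set0 by apply/setP=> x; rewrite !inE.
have free0 : free [::] = setT by apply/setP=> x; rewrite !inE.
split=> [[sigma leg gua]|W].
  have := @wins_of_guarantees g sigma k #|G| [::] leg gua isT (add0n _).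
  by rewrite /= subn0 held0 free0; apply.
exists (winning_strategy g k); first exact: winning_strategy_legal.
move=> p com fol; apply: (@winning_strategy_wins g k p [::]) => //.
by rewrite /= subn0 held0 free0.
Qed.

End Strategies.

(** * Bounds on the numbers of a disjoint union *)

Definition opening_wins (G : sgraph) t k :=
  wins (@dominating G) t k set0 setT.

Local Open Scope ereal_scope.

Lemma MBnumber_cases (G : sgraph) g :
  MBnumber G g = +oo \/ exists k, MBnumber G g = (Posz k)%:E.
Proof. by rewrite /MBnumber; case: pselect => [?|?]; [right; eexists|left]. Qed.

(** Budgets that suffice are closed upwards, hence are those from the minimum on; at infinity there
    are none. *)
Lemma MBnumber_le (G : sgraph) g k :
  MBnumber G g <= (Posz k)%:E <-> opening_wins G (dominator_turn g 0) k.
Proof.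
rewrite /opening_wins -dominator_wins_withinP /MBnumber.
case: pselect => [exk|nexk]; last first.
  by split=> // W; case: nexk; exists k; apply/asboolP.
case: ex_minnP => m /asboolP Wm m_min; rewrite lee_fin lez_nat.
split=> [lemk|Wk]; last by apply/m_min/asboolP.
have W := (dominator_wins_withinP G g m).1 Wm.
apply: (dominator_wins_withinP G g k).2; apply: (wins_monotone W) => //.
exact: implybb.
Qed.

Lemma MBnumber_wins (G : sgraph) g k :
  MBnumber G g = (Posz k)%:E -> opening_wins G (dominator_turn g 0) k.
Proof. by move=> Gk; apply/MBnumber_le; rewrite Gk. Qed.

Lemma opening_wins_sum (G H : sgraph) t k :
  opening_wins (disjoint_union G H) t k <->
  wins (sum_goal (@dominating G) (@dominating H)) t k set0 setT.
Proof.
rewrite /opening_wins.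
suff -> : @dominating (disjoint_union G H) = sum_goal (@dominating G) (@dominating H).
  by [].
by apply: funext => D; rewrite dominating_disjoint_union.
Qed.

(** The turn condition admits two D-games below the D-game, and one D-game with one S-game below the
    S-game. *)
Lemma MBnumber_union_ge (G H : sgraph) g1 g2 g :
  (if dominator_turn g 0 then dominator_turn g1 0 && dominator_turn g2 0
   else dominator_turn g1 0 (+) dominator_turn g2 0) ->
  MBnumber G g1 + MBnumber H g2 <= MBnumber (disjoint_union G H) g.
Proof.
move=> tg; have [->|[n En]] := MBnumber_cases (disjoint_union G H) g; first exact: leey.
have /opening_wins_sum/wins_sum_splits/(_ _ _ tg) := MBnumber_wins En.
rewrite !preimset0 !preimsetT => -[k1 [k2 [lek W1 W2]]].
rewrite En; apply: (@le_trans _ _ ((Posz k1)%:E + (Posz k2)%:E)).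
  by apply: leeD; apply/MBnumber_le.
by rewrite -EFinD lee_fin -PoszD lez_nat.
Qed.

(** Mixed games bound the D-game of the union, and two S-games bound its S-game. *)
Lemma MBnumber_union_le (G H : sgraph) g1 g2 g :
  ~~ (dominator_turn g1 0 && dominator_turn g2 0) ->
  dominator_turn g 0 = dominator_turn g1 0 || dominator_turn g2 0 ->
  MBnumber (disjoint_union G H) g <= MBnumber G g1 + MBnumber H g2.
Proof.
move=> ntt tg; have [->|[k1 E1]] := MBnumber_cases G g1.
  by have [->|[k2 ->]] := MBnumber_cases H g2; rewrite leey.
have [->|[k2 E2]] := MBnumber_cases H g2; first by rewrite E1 leey.
rewrite E1 E2 -EFinD -PoszD; apply/MBnumber_le/opening_wins_sum; rewrite tg.
apply: (wins_sum_merge (@dominating_mono G) (@dominating_mono H)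
  (MBnumber_wins E1) (MBnumber_wins E2) ntt); by rewrite ?preimset0 ?preimsetT.
Qed.

(** * The extremal example *)

Section K2.

Fact neq_sym : symmetric (fun x y : bool => x != y).
Proof. by move=> x y; rewrite eq_sym. Qed.

Fact neq_irr : irreflexive (fun x y : bool => x != y).
Proof. by move=> x; rewrite eqxx. Qed.

Definition K2 : sgraph := SGraph neq_sym neq_irr.

Lemma K2_dominating (A : {set K2}) v : v \in A -> dominating A.
Proof.
move=> vA; apply/forallP=> w; case: (eqVneq v w) => [<-|vw]; first by rewrite vA.
by apply/orP; right; apply/exists_inP; exists v.
Qed.

Lemma K2_MBnumber g : MBnumber K2 g = 1.
Proof.
apply/eqP; rewrite eq_le; apply/andP; split.
  have D v (F : {set K2}) : v \in F -> wins (@dominating K2) true 1 set0 F.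
    by move=> vF; apply: (wins_dom vF); apply/wins_now/(@K2_dominating _ v)/setU11.
  apply/(MBnumber_le _ _ 1); rewrite /opening_wins; case: g => /=.
    exact: (D true).
  apply: (@wins_stal _ _ _ _ _ true) => // v _.
  (* Dominator replies with the other vertex [~~ v]. *)
  by apply: (D (~~ v)); rewrite !inE; case: v.
have [->|[[|k] Ek]] := MBnumber_cases K2 g; first exact: leey.
  have /(wins_zero erefl)/forallP/(_ true) := MBnumber_wins Ek.
  by rewrite inE => /exists_inP[u]; rewrite inE.
by rewrite Ek lee_fin lez_nat.
Qed.

End K2.

Theorem theorem6p1 :
  (forall G H : sgraph,
    [/\ gammaMB G + gammaMB H <= gammaMB (disjoint_union G H),
        gammaMB (disjoint_union G H)
          <= mine (gammaMB' G + gammaMB H) (gammaMB G + gammaMB' H),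
        maxe (gammaMB' G + gammaMB H) (gammaMB G + gammaMB' H)
          <= gammaMB' (disjoint_union G H)
      & gammaMB' (disjoint_union G H) <= gammaMB' G + gammaMB' H]) /\
  [/\ exists G H : sgraph,
        [/\ (0 < #|G|)%N, (0 < #|H|)%N,
            gammaMB (disjoint_union G H) \is a fin_num
          & gammaMB G + gammaMB H = gammaMB (disjoint_union G H)],
      exists G H : sgraph,
        [/\ (0 < #|G|)%N, (0 < #|H|)%N,
            gammaMB (disjoint_union G H) \is a fin_num
          & gammaMB (disjoint_union G H)
            = mine (gammaMB' G + gammaMB H) (gammaMB G + gammaMB' H)],
      exists G H : sgraph,
        [/\ (0 < #|G|)%N, (0 < #|H|)%N,
            gammaMB' (disjoint_union G H) \is a fin_num
          & maxe (gammaMB' G + gammaMB H) (gammaMB G + gammaMB' H)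
            = gammaMB' (disjoint_union G H)]
    & exists G H : sgraph,
        [/\ (0 < #|G|)%N, (0 < #|H|)%N,
            gammaMB' (disjoint_union G H) \is a fin_num
          & gammaMB' (disjoint_union G H) = gammaMB' G + gammaMB' H]].
Proof.
have K2K2 g : MBnumber (disjoint_union K2 K2) g = 1 + 1.
  (* Each 1 is read as a number of [K2]: games [g] and [SGame] for the upper bound, [DGame] and [g]
     for the lower one, which fit the turn conditions for either [g]. *)
  apply/eqP; rewrite eq_le -{1}(K2_MBnumber g) -{1}(K2_MBnumber SGame).
  rewrite -{2}(K2_MBnumber g) -{1}(K2_MBnumber DGame).
  by rewrite MBnumber_union_le ?MBnumber_union_ge //; case: g.
have K2_gt0 : (0 < #|K2|)%N by rewrite card_bool.
split=> [G H|].
  split; rewrite ?le_min ?ge_max; first exact: MBnumber_union_ge.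
  - by apply/andP; split; apply: MBnumber_union_le.
  - by apply/andP; split; apply: MBnumber_union_ge.
  exact: MBnumber_union_le.
by split; exists K2, K2; rewrite /gammaMB /gammaMB' !K2K2 !K2_MBnumber ?minxx ?maxxx.
Qed.
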